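(* Suppose each implementable action has a pure worldview that weakly implements it and values it strictly more highly than every other pure worldview: for every $x\in X^I$ there is $i(x)\in J$ with $x\in z^*(\alpha(i(x)))$ and $u_{i(x)}(x)>u_j(x)$ for every $j\in J\setminus\{i(x)\}$. Then for every $0<\lambda,\delta<1$, for every stationary MPE that exists and every initial state, the path $(\alpha_t)$ converges to a pure worldview. The same conclusion holds almost surely under stationary randomization: for every stationary randomized MPE that exists and every fixed initial state, $(\alpha_t)$ converges to a pure worldview almost surely.
   Context: $J=\{1,\ldots,n\}$ and $X$ are nonempty finite sets (pure worldviews and actions) with payoffs $u_j(x)\in\mathbb R$. $\Delta^n=\{\alpha\in\mathbb R^n:\alpha^j\ge0,\ \sum_j\alpha^j=1\}$; $\alpha(j)$, the vertex with weight one on $j$, are the pure worldviews. $U(\alpha,x)=\sum_j\alpha^ju_j(x)$, $z^*(\alpha)=\arg\max_{x\in X}U(\alpha,x)$, $X^I=\bigcup_{\alpha\in\Delta^n}z^*(\alpha)$ (implementable actions). Pure strategies: a stationary pure strategy is a pair of arbitrary maps $\phi:\Delta^n\to\Delta^n$, $z:\Delta^n\to X$ (no continuity or measurability assumed). With $\phi^k$ the $k$-fold iterate, $$C_{\phi,z}(\beta;\alpha)=\sum_{k=0}^\infty\delta^k\big[(1-\lambda)U(\phi^k(\beta),z(\phi^k(\beta)))+\lambda U(\alpha,z(\phi^k(\beta)))\big].$$ A stationary MPE is a pair $(\phi,z)$ such that for every $\alpha$: $z(\alpha)\in z^*(\alpha)$, and $C_{\phi,z}(\phi(\alpha);\alpha)\ge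 C_{\phi,z}(\beta;\alpha)$ for every $\beta\in\Delta^n$. The path from $\alpha_0$ is $\alpha_{t+1}=\phi(\alpha_t)$, $x_t=z(\alpha_t)$. Randomized strategies: a stationary randomized strategy is a Borel probability kernel $\alpha\mapsto\Pi_\alpha$ from $\Delta^n$ to $X\times\Delta^n$, with marginals $s_\alpha$ on $X$ and $\kappa_\alpha$ on $\Delta^n$. From a fixed $\alpha_0$, conditional on the history $(\alpha_0,x_0,\ldots,x_{t-1},\alpha_t)$, the pair $(x_t,\alpha_{t+1})$ has law $\Pi_{\alpha_t}$; $\mathbb E_\beta$ is expectation when $\alpha_0=\beta$. Put $$C_\Pi(\beta;\alpha)=\mathbb E_\beta\sum_{k=0}^\infty\delta^k\big[(1-\lambda)U(\alpha_k,x_k)+\lambda U(\alpha,x_k)\big],\qquad S(\alpha)=\int C_\Pi(\beta;\alpha)\,\kappa_\alpha(d\beta).$$ $\Pi$ is a stationary randomized MPE if for every $\alpha$: $s_\alpha(z^*(\alpha))=1$ and $S(\alpha)\ge C_\Pi(\gamma;\alpha)$ for every $\gamma\in\Delta^n$. *)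

(* Defs.v *)
From HB Require Import structures.
From mathcomp Require Import all_boot all_order all_algebra.
From mathcomp Require Import all_classical all_reals all_analysis.

Set Implicit Arguments.
Unset Strict Implicit.
Unset Printing Implicit Defensive.

Import Order.TTheory GRing.Theory Num.Theory.
Import numFieldNormedType.Exports.

Local Open Scope classical_set_scope.
Local Open Scope ring_scope.

(* The simplex of R^(n+1): the set of pure worldviews is 'I_n.+1, so that it is
   never empty. *)
Definition simplex (R : realType) (n : nat) : set 'rV[R]_n.+1 :=
  [set a | (forall j, 0 <= a ord0 j) /\ \sum_j a ord0 j = 1].

(* set_type carries the subspace topology. *)
Definition worldview (R : realType) (n : nat) : Type := set_type (@simplex R n).

Lemma simplex_delta (R : realType) (n : nat) (j : 'I_n.+1) :
  delta_mx ord0 j \in @simplex R n.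
Proof.
rewrite inE; split=> [k|]; first by rewrite mxE ler0n.
rewrite (bigD1 j)//= big1 ?addr0 => [|k kj]; first by rewrite mxE !eqxx.
by rewrite mxE (negbTE kj) andbF.
Qed.

Definition vertex (R : realType) (n : nat) (j : 'I_n.+1) : worldview R n :=
  exist _ (delta_mx ord0 j) (simplex_delta R j).

HB.instance Definition _ (R : realType) (n : nat) :=
  Topological.on (worldview R n).
HB.instance Definition _ (R : realType) (n : nat) :=
  isPointed.Build (worldview R n) (vertex R ord0).

(* Borel sigma-algebra of the simplex. *)
HB.instance Definition _ (R : realType) (n : nat) :=
  @isMeasurable.Build (sigma_display (@open (worldview R n)))
    (worldview R n) <<s (@open (worldview R n)) >>
    (@sigma_algebra0 _ setT _) (@sigma_algebraC _ _)
    (@sigma_algebra_bigcup _ setT _).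

(* Finite types with a distinguished element. The theory of measurable types
   requires the element; here it only says that the type is not empty. *)
#[short(type="actionType")]
HB.structure Definition Action := {X of Finite X & isPointed X}.

(* Alias of X carrying the sigma-algebra of all subsets. *)
Definition discrete (X : actionType) : Type := X.

HB.instance Definition _ (X : actionType) := Action.on (discrete X).
HB.instance Definition _ (X : actionType) :=
  @isMeasurable.Build default_measure_display (discrete X)
    discrete_measurable discrete_measurable0
    discrete_measurableC discrete_measurableU.

Section model.
Variables (R : realType) (n : nat) (X : actionType).
Variable u : 'I_n.+1 -> X -> R.
Variables lambda delta : R.

Local Notation Delta := (worldview R n).

Definition util (a : Delta) (x : X) : R := \sum_j val a ord0 j * u j x.

Definition zstar (a : Delta) : set X := [set x | forall y, util a y <= util a x].

Definition implementable : set X := \bigcup_(a in [set: Delta]) zstar a.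

(* Evaluation at a of the realized path (b_k, x_k)_k. *)
Definition path_value (a : Delta) (b : nat -> Delta) (x : nat -> X) : R :=
  limn (series (fun k =>
    delta ^+ k * ((1 - lambda) * util (b k) (x k) + lambda * util a (x k)))).

Section pure.
Variables (phi : Delta -> Delta) (z : Delta -> X).

Definition pure_value (b a : Delta) : R :=
  path_value a (fun k => iter k phi b) (fun k => z (iter k phi b)).

Definition pure_MPE : Prop := forall a : Delta,
  zstar a (z a) /\ forall b, pure_value b a <= pure_value (phi a) a.

End pure.

Section randomized.
Variable Pi : R.-pker Delta ~> (discrete X * Delta)%type.

Definition action_marginal (a : Delta) : set (discrete X) -> \bar R :=
  pushforward (Pi a) fst.

Definition state_marginal (a : Delta) : set Delta -> \bar R :=
  pushforward (Pi a) snd.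

HB.instance Definition _ (a : Delta) :=
  Measure.copy (action_marginal a)
    (@measure_function_pushforward__canonical__measure_function_Measure
       _ _ _ _ _ (Pi a) fst measurable_fst).
HB.instance Definition _ (a : Delta) :=
  Measure.copy (state_marginal a)
    (@measure_function_pushforward__canonical__measure_function_Measure
       _ _ _ _ _ (Pi a) snd measurable_snd).

Variables (d : measure_display) (Omega : measurableType d).
Variables (al : nat -> Omega -> Delta) (xs : nat -> Omega -> discrete X).

(* sigma-algebra of the history (al_0, x_0, ..., x_{t-1}, al_t) *)
Definition history (t : nat) : set (set Omega) :=
  <<s [set E | (exists s C, [/\ (s <= t)%N, measurable C & E = al s @^-1` C]) \/
               (exists s C, [/\ (s < t)%N, measurable C & E = xs s @^-1` C])] >>.

(* The integral identity characterises Pi (al t) B as the conditional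
   probability of (xs t, al t.+1) \in B given the history. *)
Definition chain_law (P : probability Omega R) (b : Delta) : Prop :=
  [/\ (forall t, measurable_fun setT (al t)),
      (forall t, measurable_fun setT (xs t)),
      P (al 0 @^-1` [set b]) = 1%E &
      forall t (H : set Omega) (B : set (discrete X * Delta)), history t H ->
        measurable B ->
        P (H `&` [set w | B (xs t w, al t.+1 w)]) =
          (\int[P]_(w in H) Pi (al t w) B)%E].

(* A Markov family: the same coordinates al, xs on Omega serve all initial
   states, and P b is the probability under which the path starts at b. *)
Variable P : Delta -> probability Omega R.

Definition randomized_value (b a : Delta) : R :=
  fine ('E_(P b)[fun w => path_value a (al ^~ w) (xs ^~ w)])%E.

Definition randomized_MPE : Prop := forall a : Delta,
  action_marginal a (zstar a) = 1%E /\
  forall c, randomized_value c a <=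
    \int[state_marginal a]_b randomized_value b a.

End randomized.

End model.

(* Main.v *)
(* Let M(a) be the maximal utility at the state a, and S(a) the value, at a, of
   an optimal choice of the next state. Since staying at a is feasible,
   (1 - delta) S(a) >= M(a), and the Bellman equation shows that M is
   nondecreasing along the path and that the excess G = (1 - delta) S - M is at
   most (1 - lambda) times the increment of M. So G tends to 0 along the path.

   If x is optimal both at a and at the vertex p = i(x), then M is affine on the
   segment from a to p. That moving from a to a point of this segment is not
   profitable bounds the slope of the convex function G there from below; over
   the dyadic points of the segment these bounds add up to
   N c (M(p) - M(a)) / 2 <= delta G(p) + 2^N G(a) for all N, with
   c = (1 - delta) (1 - lambda). Hence M(p) - M(a) tends to 0 along the path,
   and since i(x) values x strictly most, the state gets close to the vertices
   i(x_t). Near-optimality of x_(t+1) at the state of date t then makes i(x_t)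
   eventually constant.

   Under randomization almost every successor of a state attains S, so almost
   every path satisfies the inequalities used above. *)
Require Import Defs.
From HB Require Import structures.
From mathcomp Require Import all_boot all_order all_algebra.
From mathcomp Require Import all_classical all_reals all_analysis.
From mathcomp Require Import measurable_realfun ring lra.

Import Order.TTheory GRing.Theory Num.Theory.
Import numFieldNormedType.Exports.

Local Open Scope classical_set_scope.
Local Open Scope ring_scope.

(** * Utilities and sequences of equilibrium transitions *)

Section worldviews.
Context {R : realType} {n : nat} {X : actionType}.
Variable u : 'I_n.+1 -> X -> R.
Local Notation Delta := (worldview R n).

Lemma worldview_ge0 (a : Delta) j : 0 <= val a ord0 j.
Proof. by have /set_mem[h _] := valP a. Qed.

Lemma worldview_sum (a : Delta) : \sum_j val a ord0 j = 1.
Proof. by have /set_mem[_ h] := valP a. Qed.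

Lemma worldview_le1 (a : Delta) j : val a ord0 j <= 1.
Proof.
rewrite -(worldview_sum a) (bigD1 j)//= lerDl sumr_ge0// => k _.
exact: worldview_ge0.
Qed.

Lemma util_vertex i x : util u (vertex R i) x = u i x.
Proof.
rewrite /util (bigD1 i)//= big1 => [|j ji].
  by rewrite /vertex/= mxE !eqxx mul1r addr0.
by rewrite /vertex/= mxE (negbTE ji) andbF mul0r.
Qed.

Lemma sub_util i (a : Delta) x :
  u i x - util u a x = \sum_j val a ord0 j * (u i x - u j x).
Proof.
under eq_bigr do rewrite mulrBr.
by rewrite sumrB -mulr_suml worldview_sum mul1r.
Qed.

Definition payoff_bound : R := \sum_j \sum_x `|u j x|.

Lemma le_payoff_bound j x : `|u j x| <= payoff_bound.
Proof.
rewrite /payoff_bound (bigD1 j)//= (bigD1 x)//= -addrA lerDl addr_ge0//.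
  exact: sumr_ge0.
by apply: sumr_ge0 => k _; exact: sumr_ge0.
Qed.

Lemma util_le_bound a x : `|util u a x| <= payoff_bound.
Proof.
rewrite (le_trans (ler_norm_sum _ _ _))// -[leRHS]mul1r -(worldview_sum a).
rewrite mulr_suml ler_sum// => j _; rewrite normrM ger0_norm ?worldview_ge0//.
by rewrite ler_wpM2l ?worldview_ge0// le_payoff_bound.
Qed.

Definition best (a : Delta) : X := [arg max_(x > (point : X)) util u a x]%O.

Definition best_util (a : Delta) : R := util u a (best a).

Lemma util_le_best a x : util u a x <= best_util a.
Proof. by rewrite /best_util /best; case: arg_maxP => // y _ /(_ x isT). Qed.

Lemma zstarP a x : zstar u a x <-> util u a x = best_util a.
Proof.
split=> [h|h y]; last by rewrite h util_le_best.
by apply/eqP; rewrite eq_le util_le_best h.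
Qed.

Lemma zstar_best a : zstar u a (best a).
Proof. exact/zstarP. Qed.

Lemma simplex_midpoint (a b : Delta) :
  2^-1 *: (val a + val b) \in @simplex R n.
Proof.
rewrite inE; split=> [j|].
  by rewrite !mxE mulr_ge0 ?invr_ge0// addr_ge0// worldview_ge0.
under eq_bigr do rewrite !mxE.
by rewrite -mulr_sumr big_split/= !worldview_sum; lra.
Qed.

(** Segments are only ever bisected, so midpoints stand in for general convex combinations. *)
Definition midpoint (a b : Delta) : Delta :=
  exist (fun c => c \in @simplex R n) _ (simplex_midpoint a b).

Lemma dot_midpoint (v : 'I_n.+1 -> R) a b :
  \sum_j val (midpoint a b) ord0 j * v j =
  2^-1 * (\sum_j val a ord0 j * v j + \sum_j val b ord0 j * v j).
Proof.
rewrite -big_split/= mulr_sumr; apply: eq_bigr => j _.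
by rewrite !mxE -mulrA mulrDl.
Qed.

Lemma util_midpoint a b x :
  util u (midpoint a b) x = 2^-1 * (util u a x + util u b x).
Proof. exact: dot_midpoint. Qed.

(** Utility is affine in the state: if an average of two utilities reaches the average of the two
    maxima, neither falls short of its maximum. *)
Lemma zstar_midpoint a b x y : zstar u a x -> zstar u b x ->
  zstar u (midpoint a b) y -> zstar u a y /\ zstar u b y.
Proof.
move=> /zstarP ax /zstarP bx /(_ x); rewrite !util_midpoint.
have := util_le_best a y; have := util_le_best b y => ? ? ?.
by split; apply/zstarP; lra.
Qed.

(** The maximal utility is only convex in general; a common optimal action makes it affine. *)
Lemma best_util_midpoint a b x : zstar u a x -> zstar u b x ->
  best_util (midpoint a b) = 2^-1 * (best_util a + best_util b).
Proof.
move=> ax bx.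
have [/zstarP a1 /zstarP b1] := zstar_midpoint a b x _ ax bx (zstar_best _).
by rewrite /best_util util_midpoint a1 b1.
Qed.

(** * Slope bounds for the excess along bisected segments *)

Section dynamics.
Variables lambda delta : R.
Hypotheses (hlambda : 0 < lambda < 1) (hdelta : 0 < delta < 1).

(* [S a] is the equilibrium value of choosing the next state at [a];
   [F b a] is the value, for the weights [a], of what the state [b] induces
   from the next period on. *)
Variables (S : Delta -> R) (F : Delta -> Delta -> R).
Hypothesis F_midpoint : forall b a a',
  F b (midpoint a a') = 2^-1 * (F b a + F b a').
Hypothesis F_le : forall b a, F b a <= S a.
Hypothesis F_diag : forall b, F b b = S b.
(** The left side is the value at [a] of moving to [b]: an action optimal at [b] is then optimal at
    [a] too, so it pays [best_util b] for the weights [b] and [best_util a] for the weights [a]. *)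
Hypothesis S_opt : forall a b, zstar u b `<=` zstar u a ->
  (1 - lambda) * best_util b + lambda * best_util a + delta * F b a <= S a.

(** The normalized gain of an optimal choice over earning [best_util a] in every period. *)
Let G a : R := (1 - delta) * S a - best_util a.

Lemma excess_ge0 a : 0 <= G a.
Proof. by have := S_opt a a (fun _ h => h); rewrite F_diag /G; lra. Qed.

(** Write [q] for the midpoint. As [F q] is affine in the weights and [F q p <= S p], the value
    [F q a] is at least [2 * S q - S p]. This is inserted into the condition that moving from [a] to
    [q] is not profitable. *)
Lemma excess_midpoint a p x : zstar u a x -> zstar u p x ->
  delta * (2 * G (midpoint a p) - G p) <=
  G a - (1 - delta) * (1 - lambda) * ((best_util p - best_util a) / 2).
Proof.
move=> ax px; have := F_midpoint (midpoint a p) a p.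
have := S_opt a (midpoint a p) (fun y h => (zstar_midpoint _ _ _ _ ax px h).1).
have := F_le (midpoint a p) p; rewrite F_diag /G.
rewrite (best_util_midpoint _ _ _ ax px).
move: (best_util a) (best_util p) (F _ p) (F _ a) (S (midpoint a p))
  (S a) (S p).
move=> Ma Mp Fp Fa Sq Sa Sp h1 h2 h3; move: h2.
have -> : Fa = 2 * Sq - Fp by lra.
move=> h2; have [d0 d1] := andP hdelta.
have {}d1 : 0 <= 1 - delta by rewrite subr_ge0 ltW.
have : 0 <= (1 - delta) * (delta * (Sp - Fp)).
  by rewrite mulr_ge0// mulr_ge0 ?subr_ge0// ltW.
move: h2; rewrite -subr_ge0 => /(mulr_ge0 d1); lra.
Qed.

(* The bound on [delta * G p] grows like [N] along [N] successive bisections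
   of the segment from [p] to [a]; hence [best_util] cannot increase from [a] to
   [p] by a fixed amount while [G a] is small. *)
Lemma best_util_gap N a p x : zstar u a x -> zstar u p x ->
  N%:R * ((1 - delta) * (1 - lambda) * ((best_util p - best_util a) / 2)) <=
  delta * G p + (2 ^+ N - 1) * G a.
Proof.
elim: N p => [|N IH] p ax px.
  rewrite mul0r expr0 subrr mul0r addr0 mulr_ge0 ?excess_ge0//.
  by case/andP: hdelta => /ltW.
have qx : zstar u (midpoint a p) x.
  apply/zstarP; rewrite (best_util_midpoint _ _ _ ax px) util_midpoint.
  by rewrite (zstarP _ _).1 // (zstarP p _).1.
(* From [a] to the midpoint the maximal utility rises half as much as from [a] to [p]. Doubling the
   induction hypothesis and adding the midpoint bound therefore gains one more unit. *)
have := IH _ ax qx; have := excess_midpoint _ _ _ ax px.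
rewrite (best_util_midpoint _ _ _ ax px) -natr1 exprS.
set c := (1 - delta) * (1 - lambda).
have -> : c * ((2^-1 * (best_util a + best_util p) - best_util a) / 2) =
  c * ((best_util p - best_util a) / 2) / 2 by field.
set D := c * _; set E := (2 : R) ^+ N; nra.
Qed.

End dynamics.
End worldviews.

Lemma payoff_gap {R : realType} {n : nat} {X : actionType}
    (u : 'I_n.+1 -> X -> R) :
  exists2 g : R, 0 < g & forall i j x, u j x < u i x -> g <= u i x - u j x.
Proof.
pose gap (p : 'I_n.+1 * 'I_n.+1 * X) := u p.1.1 p.2 - u p.1.2 p.2.
(* The seed 1 keeps the minimum positive when no difference is positive. *)
exists (\big[Num.min/1]_(p | 0 < gap p) gap p).
  by apply: (big_ind (fun x : R => 0 < x)) => // x y x0 y0; rewrite lt_min x0.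
move=> i j x ji; have gap0 : 0 < gap (i, j, x) by rewrite subr_gt0.
exact: (bigmin_le_cond _ _ gap0).
Qed.

Section vertex_convergence.
Context {R : realType} {n : nat}.
Local Notation Delta := (worldview R n).

Lemma worldview_sumD1 (a : Delta) i :
  \sum_(j | j != i) val a ord0 j = 1 - val a ord0 i.
Proof. by rewrite -(worldview_sum a) [in RHS](bigD1 i)//=; lra. Qed.

Lemma vertex_dist (a : Delta) i j :
  `|val (vertex R i) ord0 j - val a ord0 j| <= 1 - val a ord0 i.
Proof.
rewrite /vertex/= mxE eqxx/=; have [->|ji] := eqVneq j i.
  by rewrite ger0_norm// subr_ge0 worldview_le1.
rewrite sub0r normrN ger0_norm ?worldview_ge0// -worldview_sumD1.
by rewrite (bigD1 j)//= lerDl sumr_ge0// => k _; exact: worldview_ge0.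
Qed.

Lemma cvg_vertex (al : nat -> Delta) i :
  1 - val (al t) ord0 i @[t --> \oo] --> (0 : R) ->
  al t @[t --> \oo] --> vertex R i.
Proof.
move=> cv U [/= _ [[V oV <-] Va] sVU].
have [e /= e0 eV] := (nbhs_ballP _ _).1 (open_nbhs_nbhs (conj oV Va)).
apply: filterS ((cvgr0Pnorm_lt _).1 cv e e0) => t te.
apply: sVU => /=; apply: eV; split=> // k j.
rewrite (ord1 k) /ball/= (le_lt_trans (vertex_dist _ _ _))//.
exact: le_lt_trans (ler_norm _) te.
Qed.

End vertex_convergence.

(** * Convergence along sequences of optimal moves *)

Section convergence.
Context {R : realType} {n : nat} {X : actionType}.
Variable u : 'I_n.+1 -> X -> R.
Local Notation Delta := (worldview R n).
Hypothesis hu : forall x, implementable u x -> exists i,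
  zstar u (vertex R i) x /\ forall j, j != i -> u j x < u i x.
Variables lambda delta : R.
Hypotheses (hlambda : 0 < lambda < 1) (hdelta : 0 < delta < 1).
Variables (S : Delta -> R) (F : Delta -> Delta -> R).
Hypothesis F_midpoint : forall b a a',
  F b (midpoint a a') = 2^-1 * (F b a + F b a').
Hypothesis F_le : forall b a, F b a <= S a.
Hypothesis F_diag : forall b, F b b = S b.
Hypothesis S_opt : forall a b, zstar u b `<=` zstar u a ->
  (1 - lambda) * best_util u b + lambda * best_util u a + delta * F b a <= S a.

Let G a : R := (1 - delta) * S a - best_util u a.

(** The Bellman equation of an optimal move from [a] to [b], with the continuation bounded by
    [S a]. *)
Definition transition (a b : Delta) : Prop := exists2 y, zstar u b y &
  (1 - delta) * S a <= (1 - lambda) * best_util u b + lambda * util u a y.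

Let G_ge0 a : 0 <= G a.
Proof. exact: excess_ge0 F_diag S_opt _. Qed.

(** [best_util_gap] at a vertex, with one constant for all states and vertices: the excess at a
    vertex is bounded by the sum over all vertices, and the term [- G a] is dropped. *)
Let gap_le : exists2 K : R, 0 <= K & forall N a i x,
  zstar u a x -> zstar u (vertex R i) x ->
  N%:R * ((1 - delta) * (1 - lambda) * ((u i x - best_util u a) / 2)) <=
  K + 2 ^+ N * G a.
Proof.
exists (delta * \sum_i G (vertex R i)).
  by rewrite mulr_ge0 ?sumr_ge0//; case/andP: hdelta => /ltW.
move=> N a i x ax ix.
have := best_util_gap _ _ _ hdelta _ _ F_midpoint F_le F_diag S_opt N _ _ _ ax
  ix.
rewrite -((zstarP u _ _).1 ix) util_vertex => /le_trans; apply.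
apply: lerD; last by rewrite ler_wpM2r ?G_ge0// gerBl.
apply: ler_wpM2l; first by case/andP: hdelta => /ltW.
rewrite [leRHS](bigD1 i)//= [G (vertex R i)]/G -((zstarP u _ _).1 ix).
rewrite util_vertex lerDl.
by rewrite sumr_ge0.
Qed.

Lemma transition_cvg (al : nat -> Delta) :
  (forall t, transition (al t) (al t.+1)) ->
  exists i, al t @[t --> \oo] --> vertex R i.
Proof.
(* [y t] belongs to date [t.+1]: it is optimal at [al t.+1], and [i t] below is the vertex attached
   to it. *)
move=> tr; have [y yz ySM] : exists2 y : nat -> X,
    forall t, zstar u (al t.+1) (y t) &
    forall t, (1 - delta) * S (al t) <=
      (1 - lambda) * best_util u (al t.+1) + lambda * util u (al t) (y t).
  have [y hy] := choice (fun t => let: ex_intro2 z h1 h2 := tr t in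
    ex_intro (fun z => zstar u (al t.+1) z /\ _ <= _ + lambda * util u _ z)
      z (conj h1 h2)).
  by exists y => t; have [] := hy t.
have [i hi] := choice (fun t => hu (y t) (ex_intro2 _ _ (al t.+1) I (yz t))).
have [l0 l1] := andP hlambda; have [d0 d1] := andP hdelta.
have [g g0 hg] := payoff_gap u.
pose M t := best_util u (al t); pose incr t := M t.+1 - M t.
have G_incr t : G (al t) <= incr t.
  have := ySM t; have := util_le_best u (al t) (y t); have := G_ge0 (al t).
  rewrite /incr /M /G; nra.
have incr_cvg : incr t @[t --> \oo] --> (0 : R).
  have : cvgn M.
    apply: nondecreasing_is_cvgn.
      apply/nondecreasing_seqP => t; rewrite -subr_ge0.
      exact: le_trans (G_ge0 _) (G_incr t).
    exists (payoff_bound u) => _ [t _ <-].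
    exact: le_trans (ler_norm _) (util_le_bound _ _ _).
  move=> /[dup] cM; rewrite -cvg_shiftS => cM1.
  by rewrite -(subrr (limn M)); apply: cvgB.
(* [D t] is the rise of the maximal utility from [al t.+1] to the vertex [i t]; [w t] is the weight
   that [al t.+1] puts on the other vertices. *)
pose D t := u (i t) (y t) - M t.+1.
pose w t := 1 - val (al t.+1) ord0 (i t).
have w_ge0 t : 0 <= w t by rewrite subr_ge0 worldview_le1.
have w_le t : g * w t <= D t.
  rewrite /D /M -((zstarP u _ _).1 (yz t)) sub_util (bigD1 (i t))//=.
  rewrite subrr mulr0 add0r /w -worldview_sumD1 mulr_sumr ler_sum// => j ji.
  by rewrite mulrC ler_wpM2l ?worldview_ge0// hg// (hi t).2.
have D_ge0 t : 0 <= D t by rewrite (le_trans _ (w_le t))// mulr_ge0// ltW.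
have D_cvg : D t @[t --> \oo] --> (0 : R).
  have [K K0 hK] := gap_le.
  pose c := (1 - delta) * (1 - lambda).
  have c0 : 0 < c by rewrite mulr_gt0// subr_gt0.
  apply/cvgr0Pnorm_lt => e e0.
  (* This makes [K] less than a quarter of [N.+1 * c * e]. Eventually [2 ^+ N.+1 * G (al t.+1)] is
     less than a quarter too, and [gap_le] yields [D t < e]. *)
  have [N hN] : exists N : nat, K * 4 / (c * e) < N.+1%:R.
    exists (Num.truncn (K * 4 / (c * e))); exact: truncnS_gt.
  have N0 : 0 < N.+1%:R * c * e by rewrite mulr_gt0// mulr_gt0.
  have h0 : 0 < N.+1%:R * c * e / 4 / 2 ^+ N.+1.
    by rewrite divr_gt0 ?exprn_gt0// divr_gt0.
  have := incr_cvg; rewrite -cvg_shiftS => /cvgr0Pnorm_lt /(_ _ h0).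
  apply: filterS => t /(le_lt_trans (ler_norm _)) /(le_lt_trans (G_incr _)).
  rewrite ltr_pdivlMr// => Gt.
  have := hK N.+1 _ _ _ (yz t) (hi t).1; rewrite -/(D t) -/c => hD.
  move: hN; rewrite ltr_pdivrMr; last by rewrite mulr_gt0.
  move=> hN.
  have Nc0 : 0 < N.+1%:R * c by rewrite mulr_gt0.
  rewrite ger0_norm// -(ltr_pM2l Nc0).
  move: hN hD Gt; rewrite [c * (_ / 2)]mulrA [_ * (c * D t / 2)]mulrA.
  move: (G _) (2 ^+ _) (N.+1%:R) => Ga E N1; lra.
(* If the vertex changes, [i t.+1] values [y t.+1] more than [i t] does by at least [g]. This
   difference splits into [D t.+1], the shortfall of [y t.+1] at [al t.+1] below [M t.+2], and a
   term due to the distance of [al t.+1] from the vertex [i t]. *)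
have hconst t : i t.+1 != i t ->
    g <= D t.+1 + lambda^-1 * incr t.+1 + 2 * payoff_bound u * w t.
  move=> it; have ge : g <= u (i t.+1) (y t.+1) - u (i t) (y t.+1).
    by apply: hg; apply: (hi t.+1).2; rewrite eq_sym.
  have : util u (al t.+1) (y t.+1) - u (i t) (y t.+1)
      <= 2 * payoff_bound u * w t.
    rewrite -opprB sub_util -sumrN (bigD1 (i t))//= subrr mulr0 oppr0 add0r.
    rewrite /w -worldview_sumD1 mulr_sumr ler_sum// => j _.
    rewrite -mulrN opprB mulrC ler_wpM2r ?worldview_ge0//.
    have := le_payoff_bound u j (y t.+1).
    have := le_payoff_bound u (i t) (y t.+1).
    by rewrite !ler_norml => /andP[? ?] /andP[? ?]; lra.
  (* By [G >= 0] and the transition, [M t.+1] is at most [(1 - lambda) * M t.+2 + lambda * util u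
     (al t.+1) (y t.+1)]. *)
  have : M t.+2 - util u (al t.+1) (y t.+1) <= lambda^-1 * incr t.+1.
    rewrite ler_pdivlMl// /incr.
    have := ySM t.+1; have := G_ge0 (al t.+1); rewrite /G /M; lra.
  by move: ge; rewrite /D; lra.
have w_cvg : w t @[t --> \oo] --> (0 : R).
  have Dg : g^-1 * D t @[t --> \oo] --> (0 : R).
    by rewrite -(mulr0 g^-1); apply: cvgMl_tmp.
  apply: (squeeze_cvgr _ (cvg_cst 0) Dg).
  by apply: nearW => t; rewrite w_ge0 /= ler_pdivlMl.
have : D t.+1 + lambda^-1 * incr t.+1 + 2 * payoff_bound u * w t
    @[t --> \oo] --> (0 : R).
  rewrite -[0]addr0 -[X in X + _]addr0; apply: cvgD; [apply: cvgD|].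
  - by rewrite cvg_shiftS.
  - by rewrite -(mulr0 lambda^-1); apply: cvgMl_tmp; rewrite cvg_shiftS.
  - by rewrite -(mulr0 (2 * payoff_bound u)); apply: cvgMl_tmp.
move=> /cvgr0Pnorm_lt /(_ _ g0) [T _ hT].
have iT k : i (T + k)%N = i T.
  elim: k => [|k <-]; first by rewrite addn0.
  apply/eqP; apply: contraPT (hT (T + k)%N (leq_addr _ _)) => /=.
  rewrite addnS => /hconst /le_trans h.
  by apply/negP; rewrite -leNgt h// ler_norm.
exists (i T); apply: cvg_vertex; rewrite -cvg_shiftS.
apply: cvg_trans w_cvg; apply: near_eq_cvg; exists T => // t /= Tt.
by rewrite /w -(subnKC Tt) iT.
Qed.
End convergence.

(** * Discounted sums and pure equilibria *)

Definition discounted {R : realType} (delta : R) (a : nat -> R) : R :=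
  limn (series (fun k => delta ^+ k * a k)).

Section discounted.
Context {R : realType}.
Variable delta : R.
Hypothesis hdelta : 0 < delta < 1.
Implicit Types (K c : R) (a b : nat -> R).

Let delta_ge0 : 0 <= delta. Proof. by case/andP: hdelta => /ltW. Qed.

Let delta_norm : `|delta| < 1.
Proof. by rewrite ger0_norm//; case/andP: hdelta. Qed.

Lemma cvg_discounted K a : (forall k, `|a k| <= K) ->
  series (fun k => delta ^+ k * a k) @ \oo --> discounted delta a.
Proof.
move=> aK; apply: (@normed_cvg R R^o).
apply: (@series_le_cvg _ _ (geometric K delta)) => [k|k|k|].
- exact: normr_ge0.
- by rewrite /= mulr_ge0 ?exprn_ge0// (le_trans _ (aK 0)).
- by rewrite [leLHS]normrM ger0_norm ?exprn_ge0// /= mulrC ler_wpM2r ?exprn_ge0.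
- exact: is_cvg_geometric_series.
Qed.

Lemma discounted_unique a l :
  series (fun k => delta ^+ k * a k) @ \oo --> l -> discounted delta a = l.
Proof. exact: cvg_lim. Qed.

Lemma discountedD K a b : (forall k, `|a k| <= K) -> (forall k, `|b k| <= K) ->
  discounted delta (fun k => a k + b k) =
  discounted delta a + discounted delta b.
Proof.
move=> aK bK; apply: discounted_unique.
apply: cvg_trans (cvgD (cvg_discounted _ _ aK) (cvg_discounted _ _ bK));
  apply: near_eq_cvg; apply: nearW => N.
rewrite /series/= !fctE -big_split/=; apply: eq_bigr => k _.
by rewrite mulrDr.
Qed.

Lemma discountedZ K c a : (forall k, `|a k| <= K) ->
  discounted delta (fun k => c * a k) = c * discounted delta a.
Proof.
move=> aK; apply: discounted_unique.
apply: cvg_trans (cvgMl_tmp (a := c) (cvg_discounted _ _ aK));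
  apply: near_eq_cvg; apply: nearW => N.
rewrite /series/= mulr_sumr; apply: eq_bigr => k _; ring.
Qed.

Lemma discounted_le K a : (forall k, `|a k| <= K) ->
  `|discounted delta a| <= K / (1 - delta).
Proof.
move=> aK.
have cv : `|series (fun k => delta ^+ k * a k) N| @[N --> \oo] -->
    `|discounted delta a| by apply: cvg_norm; exact: cvg_discounted aK.
have K0 : 0 <= K by exact: le_trans (aK 0).
rewrite -(cvg_lim _ cv)//; apply: limr_le; first exact: cvgP cv.
apply: nearW => N.
rewrite (le_trans (ler_norm_sum _ _ _))//.
have h : series (geometric K delta) @ \oo --> K / (1 - delta).
  exact: cvg_geometric_series.
rewrite -(cvg_lim _ h)//.
apply: le_trans (nondecreasing_cvgn_le _ (cvgP _ h) N).
  apply: ler_sum => k _.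
  by rewrite normrM ger0_norm ?exprn_ge0// /= mulrC ler_wpM2r ?exprn_ge0.
apply: nondecreasing_series => k _ _.
by rewrite /= mulr_ge0 ?exprn_ge0.
Qed.

Lemma discounted_rec K a : (forall k, `|a k| <= K) ->
  discounted delta a = a 0%N + delta * discounted delta (fun k => a k.+1).
Proof.
move=> aK; apply: discounted_unique; rewrite -cvg_shiftS.
have h := cvg_discounted _ (fun k => a k.+1) (fun k => aK k.+1).
have {}h : a 0%N + delta * series (fun k => delta ^+ k * a k.+1) N
    @[N --> \oo] --> a 0%N + delta * discounted delta (fun k => a k.+1).
  by apply: cvgD; [exact: cvg_cst|exact: cvgMl_tmp h].
apply: cvg_trans h; apply: near_eq_cvg; apply: nearW => N.
rewrite /series/= big_nat_recl//= expr0 mul1r; congr (_ + _).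
by rewrite mulr_sumr; apply: eq_bigr => k _; rewrite exprS mulrA.
Qed.

(** The bound depends on the sequence only through [K]; this uniformity later lets means pass
    through the infinite sum. *)
Lemma discounted_tail K a N : (forall k, `|a k| <= K) ->
  `|discounted delta a - series (fun k => delta ^+ k * a k) N| <=
  delta ^+ N * (K / (1 - delta)).
Proof.
elim: N a => [|N IH] a aK.
  by rewrite /series/= big_geq// subr0 expr0 mul1r discounted_le.
rewrite (discounted_rec _ _ aK) /series/= big_nat_recl//= expr0 mul1r opprD.
rewrite addrACA subrr add0r.
under [X in _ - X]eq_bigr do rewrite exprS -mulrA.
rewrite -mulr_sumr -mulrBr normrM ger0_norm// exprS -mulrA ler_wpM2l//.
by apply: IH => k.
Qed.

Lemma discounted_sum (I : finType) K (v : I -> R) (a : I -> nat -> R) :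
  (forall i k, `|a i k| <= K) ->
  discounted delta (fun k => \sum_i v i * a i k) =
  \sum_i v i * discounted delta (a i).
Proof.
move=> aK; apply: discounted_unique.
under [X in _ --> X]eq_bigr do rewrite -(discountedZ _ _ _ (aK _)).
have h : forall i, series (fun k => delta ^+ k * (v i * a i k)) @ \oo -->
    discounted delta (fun k => v i * a i k).
  move=> i; apply: (cvg_discounted (`|v i| * K)) => k.
  by rewrite normrM ler_wpM2l.
have hs : \sum_i series (fun k => delta ^+ k * (v i * a i k)) N @[N --> \oo] -->
    \sum_i discounted delta (fun k => v i * a i k).
  by apply: cvg_big => [|i _]; [exact: add_continuous|exact: h].
apply: cvg_trans hs; apply: near_eq_cvg; apply: nearW => N.
rewrite /series/= exchange_big/=; apply: eq_bigr => k _.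
by rewrite mulr_sumr.
Qed.

End discounted.

(** * Discounted values of paths *)

Section path_values.
Context {R : realType} {n : nat} {X : actionType}.
Variable u : 'I_n.+1 -> X -> R.
Local Notation Delta := (worldview R n).
Variables lambda delta : R.
Hypotheses (hlambda : 0 < lambda < 1) (hdelta : 0 < delta < 1).

Definition path_reward (a b : Delta) (x : X) : R :=
  (1 - lambda) * util u b x + lambda * util u a x.

Lemma path_reward_le a b x : `|path_reward a b x| <= payoff_bound u.
Proof.
have := util_le_bound u a x; have := util_le_bound u b x.
have [l0 l1] := andP hlambda.
by rewrite /path_reward !ler_norml => /andP[? ?] /andP[? ?]; apply/andP; nra.
Qed.

Lemma path_valueE a b x : path_value u lambda delta a b x =
  discounted delta (fun k => path_reward a (b k) (x k)).
Proof. by []. Qed.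

Lemma path_value_rec a b x : path_value u lambda delta a b x =
  path_reward a (b 0) (x 0) +
  delta * path_value u lambda delta a (fun k => b k.+1) (fun k => x k.+1).
Proof.
by rewrite !path_valueE (discounted_rec _ _ (payoff_bound u))// => k;
  exact: path_reward_le.
Qed.

(** Separates the weights [a] from the path: the value is affine in [a], and its coefficients can be
    averaged one by one. *)
Lemma path_value_split a b x : path_value u lambda delta a b x =
  (1 - lambda) * discounted delta (fun k => util u (b k) (x k)) +
  lambda * \sum_j val a ord0 j * discounted delta (fun k => u j (x k)).
Proof.
have [l0 l1] := andP hlambda.
have scale c (h : 0 <= c <= 1) d y :
    `|util u d y| <= payoff_bound u -> `|c * util u d y| <= payoff_bound u.
  move=> hy; have [c0 c1] := andP h.
  by rewrite normrM ger0_norm// -[leRHS]mul1r ler_pM.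
rewrite path_valueE (discountedD _ _ (payoff_bound u))//; first last.
- by move=> k; rewrite scale ?util_le_bound// !ltW.
- by move=> k; rewrite scale ?util_le_bound// subr_ge0 lerBlDr lerDl !ltW.
rewrite !(discountedZ _ _ (payoff_bound u))//; do ?by move=> k;
  exact: util_le_bound.
by rewrite (discounted_sum _ _ _ (payoff_bound u))// => j k;
  exact: le_payoff_bound.
Qed.

Lemma path_value_midpoint a a' b x :
  path_value u lambda delta (midpoint a a') b x =
  2^-1 * (path_value u lambda delta a b x + path_value u lambda delta a' b x).
Proof. by rewrite !path_value_split dot_midpoint; lra. Qed.

End path_values.

(** The sequence argument applies with [S a] the value at [a] of moving to [phi a], and [F b a] that
    of moving to [phi b]; the bound of [F] by [S] is then the equilibrium condition itself. *)
Lemma pure_MPE_cvg {R : realType} {n : nat} {X : actionType}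
  (u : 'I_n.+1 -> X -> R)
  (hu : forall x : X, implementable u x ->
    exists i : 'I_n.+1, zstar u (vertex R i) x /\
      forall j : 'I_n.+1, j != i -> u j x < u i x)
  (lambda delta : R) (hlambda : 0 < lambda < 1) (hdelta : 0 < delta < 1)
  (phi : worldview R n -> worldview R n) (z : worldview R n -> X) a0 :
  pure_MPE u lambda delta phi z ->
  exists i, iter t phi a0 @[t --> \oo] --> vertex R i.
Proof.
move=> mpe; have zP a := (zstarP u _ _).1 (mpe a).1.
pose C b a := pure_value u lambda delta phi z b a.
have C_rec b a : C b a = (1 - lambda) * best_util u b +
    lambda * util u a (z b) + delta * C (phi b) a.
  rewrite /C/pure_value path_value_rec//= /path_reward zP; congr (_ + _ * _).
  by congr path_value; apply/funext => k; rewrite -iterS iterSr.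
apply: (transition_cvg u hu _ _ hlambda hdelta (fun a => C (phi a) a)
  (fun b a => C (phi b) a)).
- by move=> b a a'; exact: path_value_midpoint.
- by move=> b a; apply: (mpe a).2.
- by [].
- move=> a b /(_ _ (mpe b).1)/zstarP <-; rewrite -C_rec; exact: (mpe a).2.
move=> t; exists (z (iter t.+1 phi a0)); first exact: (mpe _).1.
have := C_rec (phi (iter t phi a0)) (iter t phi a0).
have := (mpe (iter t phi a0)).2 (phi (phi (iter t phi a0)));
  rewrite -/(C _ _) /=.
rewrite -/(C _ _).
have [d0 d1] := andP hdelta; move: (C _ _) (C _ _) => c1 c2; nra.
Qed.

(** * Means of bounded measurable functions *)

(** Such functions are integrable for every probability measure and stable under the operations
    used, so linearity of means needs a single side condition. *)
Definition bounded_mfun {d} {T : measurableType d} {R : realType}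
    (f : T -> R) : Prop :=
  measurable_fun setT f /\ exists K : R, forall x, `|f x| <= K.

Section bounded_mfun.
Context {d : measure_display} {T : measurableType d} {R : realType}.
Implicit Types f g : T -> R.

Lemma bounded_mfun_cst (c : R) : bounded_mfun (fun _ : T => c).
Proof. by split; [exact: measurable_cst|exists `|c|]. Qed.

Lemma bounded_mfunD f g : bounded_mfun f -> bounded_mfun g ->
  bounded_mfun (fun x => f x + g x).
Proof.
move=> [mf [K fK]] [mg [L gL]]; split; first exact: measurable_funD.
by exists (K + L) => x; rewrite (le_trans (ler_normD _ _))// lerD.
Qed.

Lemma bounded_mfunZ (c : R) f : bounded_mfun f ->
  bounded_mfun (fun x => c * f x).
Proof.
move=> [mf [K fK]]; split; first exact: measurable_funM.
by exists (`|c| * K) => x; rewrite normrM ler_wpM2l.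
Qed.

Lemma bounded_mfun_sum (I : finType) (f : I -> T -> R) :
  (forall i, bounded_mfun (f i)) -> bounded_mfun (fun x => \sum_i f i x).
Proof.
move=> bf; split; first by apply: measurable_sum => i; have [] := bf i.
have [K hK] := choice (fun i => (bf i).2); exists (\sum_i K i) => x.
by rewrite (le_trans (ler_norm_sum _ _ _))// ler_sum.
Qed.

Lemma bounded_mfun_comp {d'} {T' : measurableType d'} f (h : T' -> T) :
  measurable_fun setT h -> bounded_mfun f -> bounded_mfun (f \o h).
Proof.
move=> mh [mf [K fK]]; split; first exact: measurableT_comp.
by exists K => x; exact: fK.
Qed.

Section mean.
Variable mu : {measure set T -> \bar R}.
Hypothesis mu1 : mu setT = 1%E.

Lemma bounded_mfun_integrable f : bounded_mfun f ->
  mu.-integrable setT (EFin \o f).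
Proof.
move=> [mf [K fK]]; apply: measurable_bounded_integrable => //.
  by rewrite mu1 ltry.
exists K; split; first exact: num_real.
by move=> y Ky x _; exact: le_trans (fK x) (ltW Ky).
Qed.

Lemma mean_cst (c : R) : \int[mu]_x c = c.
Proof. by rewrite Rintegral_cst// mu1/= mulr1. Qed.

Lemma meanD f g : bounded_mfun f -> bounded_mfun g ->
  \int[mu]_x (f x + g x) = \int[mu]_x f x + \int[mu]_x g x.
Proof. by move=> bf bg; rewrite RintegralD//;
  exact: bounded_mfun_integrable. Qed.

Lemma meanZ (c : R) f : bounded_mfun f ->
  \int[mu]_x (c * f x) = c * \int[mu]_x f x.
Proof. by move=> bf; rewrite RintegralZl//; exact: bounded_mfun_integrable. Qed.

Lemma mean_sum (I : finType) (f : I -> T -> R) :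
  (forall i, bounded_mfun (f i)) ->
  \int[mu]_x \sum_i f i x = \sum_i \int[mu]_x f i x.
Proof.
move=> bf; elim: (index_enum I) => [|i s IH].
  by rewrite big_nil; under eq_Rintegral do rewrite big_nil; rewrite mean_cst.
under eq_Rintegral do rewrite big_cons.
rewrite big_cons -IH meanD// {IH}; elim: s => [|j s IH].
  by under eq_fun do rewrite big_nil; exact: bounded_mfun_cst.
by under eq_fun do rewrite big_cons; exact: bounded_mfunD.
Qed.

Lemma mean_le f g : bounded_mfun f -> bounded_mfun g ->
  (forall x, f x <= g x) -> \int[mu]_x f x <= \int[mu]_x g x.
Proof.
by move=> bf bg fg; apply: le_Rintegral => //; exact: bounded_mfun_integrable.
Qed.

Lemma mean_norm_le (K : R) f : measurable_fun setT f ->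
  (forall x, `|f x| <= K) -> `|\int[mu]_x f x| <= K.
Proof.
move=> mf fK; have bf : bounded_mfun f by split=> //; exists K.
rewrite ler_norml -{1}(mean_cst (- K)) -{2}(mean_cst K).
by apply/andP; split; apply: mean_le => //; do ?exact: bounded_mfun_cst;
  move=> x; have := fK x; rewrite ler_norml => /andP[].
Qed.

Lemma full_measure_ae (A : set T) : measurable A -> mu A = 1%E ->
  {ae mu, forall x, A x}.
Proof.
move=> mA A1; exists (~` A); split=> //; first exact: measurableC.
have fin : (mu setT < +oo)%E by rewrite mu1 ltry.
rewrite -setTD measureD// setTI; transitivity (mu setT - mu A)%E => //.
by rewrite mu1 A1 subee.
Qed.

Lemma sub_ae (A B : T -> Prop) : (forall x, A x -> B x) ->
  {ae mu, forall x, A x} -> {ae mu, forall x, B x}.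
Proof. by move=> AB; apply: filterS. Qed.

Lemma negligible_countable_bigcup (I : countType) (E : I -> set T) :
  (forall i, mu.-negligible (E i)) ->
  mu.-negligible (\bigcup_(i in [set: I]) E i).
Proof.
move=> hE; pose E' m := if unpickle m is Some i then E i else set0.
suff : mu.-negligible (\bigcup_m E' m).
  apply: negligibleS => x [i _ Eix].
  by exists (pickle i) => //; rewrite /E' pickleK.
apply: negligible_bigcup => m; rewrite /E'.
by case: unpickle => [i|]; [exact: hE|exact: negligible_set0].
Qed.

Lemma mean_eq_ae f g : bounded_mfun f -> bounded_mfun g ->
  {ae mu, forall x, f x = g x} -> \int[mu]_x f x = \int[mu]_x g x.
Proof.
move=> [mf _] [mg _] fg; congr fine; apply: ae_eq_integral => //.
- exact/measurable_EFinP.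
- exact/measurable_EFinP.
- by apply: filterS fg => x /= -> _.
Qed.

(** The nonnegative function [c - f] has mean zero, hence vanishes almost everywhere. This turns
    optimality on average into optimality of almost every successor. *)
Lemma mean_max_ae (c : R) f : bounded_mfun f -> (forall x, f x <= c) ->
  \int[mu]_x f x = c -> {ae mu, forall x, f x = c}.
Proof.
move=> bf fc mfc.
have bg : bounded_mfun (fun x => c + - 1 * f x).
  by apply: bounded_mfunD; [exact: bounded_mfun_cst|exact: bounded_mfunZ].
have g0 x : 0 <= c + - 1 * f x by rewrite mulN1r subr_ge0.
have : (\int[mu]_x `|(c + - 1 * f x)%:E| = 0)%E.
  under eq_integral do rewrite gee0_abs ?lee_fin//.
  rewrite -[LHS]fineK; last exact: integrable_fin_num (bounded_mfun_integrable
    _ bg).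
  rewrite -/(Rintegral mu setT (fun x => c + - 1 * f x)) meanD//; first last.
  - exact: bounded_mfunZ.
  - exact: bounded_mfun_cst.
  by rewrite mean_cst meanZ// mfc mulN1r subrr.
move=> /(ae_eq_integral_abs _ measurableT) h.
have /h : measurable_fun setT (fun x => (c + - 1 * f x)%:E).
  by apply/measurable_EFinP; case: bg.
apply: filterS => x /= /(_ I) [] /eqP.
by rewrite mulN1r subr_eq0 => /eqP.
Qed.

End mean.
End bounded_mfun.

Section discounted_mean.
Context {d : measure_display} {T : measurableType d} {R : realType}.
Variable delta : R.
Hypothesis hdelta : 0 < delta < 1.
Variables (K : R) (f : nat -> T -> R).
Hypotheses (mf : forall k, measurable_fun setT (f k))
  (fK : forall k x, `|f k x| <= K).

Lemma bounded_mfun_discounted :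
  bounded_mfun (fun x => discounted delta (f ^~ x)).
Proof.
split; last by exists (K / (1 - delta)) => x; exact: discounted_le.
pose h N x := series (fun k => delta ^+ k * f k x) N.
apply: (@measurable_fun_cvg _ _ _ _ h) => [N|x _].
  by apply: measurable_sum => k; exact: measurable_funM.
exact: (cvg_discounted _ hdelta K).
Qed.

(** The discounted tails are small uniformly in [x], so linearity for the partial sums suffices. *)
Lemma mean_discounted (mu : {measure set T -> \bar R}) : mu setT = 1%E ->
  \int[mu]_x discounted delta (f ^~ x) =
  discounted delta (fun k => \int[mu]_x f k x).
Proof.
move=> mu1; apply/esym/discounted_unique.
have bf k : bounded_mfun (f k) by split => //; exists K.
have bs N : bounded_mfun (fun x => \sum_(k < N) delta ^+ k * f k x).
  by apply: bounded_mfun_sum => k; exact: bounded_mfunZ.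
have sE N : series (fun k => delta ^+ k * \int[mu]_x f k x) N =
    \int[mu]_x \sum_(k < N) delta ^+ k * f k x.
  rewrite /series/= big_mkord mean_sum//; last by move=> k;
    exact: bounded_mfunZ.
  by apply: eq_bigr => k _; rewrite meanZ.
have cv0 : delta ^+ N * (K / (1 - delta)) @[N --> \oo] --> (0 : R).
  rewrite -(mul0r (K / (1 - delta))); apply: cvgMl; apply: cvg_expr.
  by rewrite ger0_norm; case/andP: hdelta => // /ltW.
apply/cvgrPdist_lt => e e0.
apply: filterS ((cvgr0Pnorm_lt _).1 cv0 e e0) => N /(le_lt_trans (ler_norm _)).
apply: le_lt_trans; rewrite sE -[X in `|_ + X|]mulN1r -meanZ// -meanD//;
  last 2 first.
- exact: bounded_mfun_discounted.
- exact: bounded_mfunZ.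
have [mg _] := bounded_mfunD _ _ bounded_mfun_discounted (bounded_mfunZ (-1) _
  (bs N)).
apply: mean_norm_le => // x; rewrite mulN1r.
have := discounted_tail _ hdelta K (f ^~ x) N (fK ^~ x).
by rewrite /series/= big_mkord.
Qed.

End discounted_mean.

(** * Integration against mixtures of a kernel *)

Section mixture.
Context {d d1 d2 : measure_display} {Omega : measurableType d}
  {Y : measurableType d1} {Z : measurableType d2} {R : realType}.
Variables (k : R.-pker Y ~> Z) (f : Omega -> Y).
Hypothesis mf : measurable_fun setT f.

(* The dummy factor [unit] is required by [integral_kcomp]. *)
Definition reindexed_kernel (p : unit * Omega) : {measure set Z -> \bar R} :=
  k (f p.2).

Let measurable_reindexed U : measurable U ->
  measurable_fun setT (reindexed_kernel ^~ U).
Proof.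
move=> mU; apply: (measurableT_comp (measurable_kernel k U mU)).
exact: measurableT_comp.
Qed.

HB.instance Definition _ :=
  isKernel.Build _ _ _ _ R reindexed_kernel measurable_reindexed.

Let prob_reindexed p : reindexed_kernel p setT = 1%E.
Proof. exact: prob_kernel. Qed.

HB.instance Definition _ :=
  Kernel_isProbability.Build _ _ _ _ R reindexed_kernel prob_reindexed.

(** Both sides integrate [h] for the law of [g], which is the composition of [P], seen as a constant
    kernel on a one-point space, with the reindexed kernel. *)
Lemma ge0_integral_mixture (P : probability Omega R) (g : Omega -> Z) h :
  measurable_fun setT g ->
  (forall B, measurable B -> P (g @^-1` B) = \int[P]_w k (f w) B)%E ->
  measurable_fun setT h -> (forall z, 0 <= h z)%E ->
  (\int[P]_w h (g w) = \int[P]_w \int[k (f w)]_z h z)%E.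
Proof.
move=> mg law mh h0.
have mP : measurable_fun [set: unit] (cst (P : pprobability Omega R)).
  exact: measurable_cst.
have := integral_kcomp (kprobability mP) reindexed_kernel tt h0 mh.
rewrite /= => <-; transitivity (\int[pushforward P g]_z h z)%E.
  by rewrite ge0_integral_pushforward.
by apply: eq_measure_integral => B mB _; exact: law.
Qed.

Lemma bounded_mfun_kernel (h : Z -> R) : bounded_mfun h ->
  bounded_mfun (fun y => \int[k y]_z h z).
Proof.
move=> bh; have [mh [K hK]] := bh; split; last first.
  by exists K => y; apply: mean_norm_le => //; exact: prob_kernel.
have bK := bounded_mfunD _ _ bh (bounded_mfun_cst K).
(* The shift by [K] makes the integrand nonnegative, as [measurable_fun_integral_kernel]
   requires. *)
have -> : (fun y => \int[k y]_z h z) = (fun y => \int[k y]_z (h z + K) - K).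
  apply/funext => y; rewrite meanD ?prob_kernel//; last exact: bounded_mfun_cst.
  by rewrite mean_cst ?prob_kernel// addrK.
apply: measurable_funB => //.
apply: (@measurableT_comp _ _ _ _ _ _ fine) => //.
apply: measurable_fun_integral_kernel => [U mU|z|].
- exact: measurable_kernel.
- by rewrite lee_fin -lerBlDr sub0r; have := hK z; rewrite ler_norml => /andP[].
- by apply/measurable_EFinP; case: bK.
Qed.

Lemma mean_mixture (P : probability Omega R) (g : Omega -> Z) h :
  measurable_fun setT g ->
  (forall B, measurable B -> P (g @^-1` B) = \int[P]_w k (f w) B)%E ->
  bounded_mfun h ->
  \int[P]_w h (g w) = \int[P]_w \int[k (f w)]_z h z.
Proof.
move=> mg law bh; have [mh [K hK]] := bh.
have bc := @bounded_mfun_cst _ _ R K.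
have bK := bounded_mfunD _ _ bh (bounded_mfun_cst K).
suff : \int[P]_w (h (g w) + K) = \int[P]_w \int[k (f w)]_z (h z + K).
  have P1 := @probability_setT _ _ _ P.
  rewrite meanD//; last exact: bounded_mfun_comp mg bh.
  under [in RHS]eq_Rintegral.
    move=> w _; rewrite meanD ?prob_kernel//.
    rewrite mean_cst ?prob_kernel//.
  over.
  rewrite /= meanD//; first by move/addIr.
  exact: (bounded_mfun_comp _ _ mf (bounded_mfun_kernel _ bh)).
congr fine; rewrite (ge0_integral_mixture P g (fun z => (h z + K)%:E))//.
- apply: eq_integral => w _; rewrite fineK//.
  exact: integrable_fin_num (bounded_mfun_integrable _ (prob_kernel _) _ bK).
- by apply/measurable_EFinP; case: bK.
- by move=> z; rewrite lee_fin -lerBlDr sub0r; have := hK z;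
    rewrite ler_norml => /andP[].
Qed.

End mixture.

(** * Transition operator and resolvent *)

Section resolvent.
Context {d1 d2 : measure_display} {Y : measurableType d1}
  {Z : measurableType d2} {R : realType}.
Variables (Pi : R.-pker Y ~> (Z * Y)%type) (delta : R).
Hypothesis hdelta : 0 < delta < 1.

Implicit Types h : Y -> R.

Definition next_mean (h : Y -> R) (y : Y) : R := \int[Pi y]_z h z.2.

(** The expected discounted sum of [h] along the chain started at [y], written with powers of the
    transition operator and thus without a path space. *)
Definition resolvent (h : Y -> R) (y : Y) : R :=
  discounted delta (fun m => iter m next_mean h y).

Lemma bounded_mfun_next_mean h : bounded_mfun h -> bounded_mfun (next_mean h).
Proof.
by move=> bh; exact: bounded_mfun_kernel (bounded_mfun_comp _ _ measurable_snd
  bh).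
Qed.

Lemma next_mean_le (K : R) h : measurable_fun setT h ->
  (forall y, `|h y| <= K) -> forall y, `|next_mean h y| <= K.
Proof.
move=> mh hK y; apply: mean_norm_le => //; first exact: prob_kernel.
exact: measurableT_comp mh measurable_snd.
Qed.

Lemma bounded_mfun_iter_next h m :
  bounded_mfun h -> bounded_mfun (iter m next_mean h).
Proof.
by move=> bh; elim: m => [//|m IH] /=; exact: bounded_mfun_next_mean.
Qed.

Lemma iter_next_mean_le (K : R) h m : measurable_fun setT h ->
  (forall y, `|h y| <= K) -> forall y, `|iter m next_mean h y| <= K.
Proof.
move=> mh hK; have bh : bounded_mfun h by split=> //; exists K.
elim: m => [//|m IH] /=; apply: next_mean_le => //.
by have [] := bounded_mfun_iter_next _ m bh.
Qed.

Lemma bounded_mfun_resolvent h : bounded_mfun h -> bounded_mfun (resolvent h).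
Proof.
move=> bh; have [mh [K hK]] := bh.
apply: (bounded_mfun_discounted _ hdelta K) => m.
  by have [] := bounded_mfun_iter_next _ m bh.
exact: iter_next_mean_le.
Qed.

Lemma resolvent_rec h y : bounded_mfun h ->
  resolvent h y = h y + delta * next_mean (resolvent h) y.
Proof.
move=> bh; have [mh [K hK]] := bh.
rewrite /resolvent (discounted_rec _ hdelta K)/=; last first.
  by move=> m; exact: iter_next_mean_le.
congr (_ + _ * _); rewrite [in RHS]/next_mean.
rewrite (mean_discounted _ hdelta K (fun m z => iter m next_mean h z.2))//.
- move=> m; have [mi _] := bounded_mfun_iter_next _ m bh.
  exact: measurableT_comp mi measurable_snd.
- by move=> m z; exact: iter_next_mean_le.
- exact: prob_kernel.
Qed.

End resolvent.

(** * Markov chains on the simplex and randomized equilibria *)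

Section measurability.
Context {R : realType} {n : nat} {X : actionType}.
Variable u : 'I_n.+1 -> X -> R.
Local Notation Delta := (worldview R n).

Lemma measurable_weight j : measurable_fun setT (fun a : Delta => val a ord0 j).
Proof.
apply: (measurability _ (RGenOpens.measurableE R)) => _ [_ [x [y ->]] <-].
rewrite setTI; apply: sub_sigma_algebra.
have /continuousP : continuous (fun a : Delta => val a ord0 j).
  move=> a; have ca : {for a, continuous (val : Delta -> 'rV[R]_n.+1)}.
    exact: (@initial_continuous _ _ (val : Delta -> 'rV[R]_n.+1)).
  exact: (continuous_comp ca (@coord_continuous _ _ _ ord0 j _)).
by apply; exact: interval_open.
Qed.

Lemma measurable_worldview1 (b : Delta) : measurable [set b].
Proof.
have -> : [set b] = \bigcap_(j in [set: 'I_n.+1])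
    ((fun a : Delta => val a ord0 j) @^-1` [set val b ord0 j]).
  apply/seteqP; split=> [a -> //|a ab]; apply: val_inj.
  by apply/rowP => j; exact: ab.
apply: fin_bigcap_measurable => // j _.
by rewrite -[X in measurable X]setTI; apply: measurable_weight.
Qed.

Lemma bounded_mfun_util x : bounded_mfun (util u ^~ x).
Proof.
apply: bounded_mfun_sum => j; split.
  by apply: measurable_funM; [exact: measurable_weight|exact: measurable_cst].
exists `|u j x| => a.
by rewrite normrM ger0_norm ?worldview_ge0// ler_piMl// worldview_le1.
Qed.

Lemma bounded_mfun_best_util : bounded_mfun (best_util u).
Proof.
split; last by exists (payoff_bound u) => a; exact: util_le_bound.
apply: (measurability _ (RGenOInfty.measurableE R)) => _ [_ [c ->] <-].
have -> : setT `&` best_util u @^-1` `]c, +oo[%classic =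
    \bigcup_(x in [set: X]) (util u ^~ x @^-1` `]c, +oo[%classic).
  apply/seteqP; split=> [a [_]|a [x _]] /=; rewrite !in_itv/= !andbT => h.
    by exists (best u a) => //=; rewrite in_itv/= andbT.
  by split=> //; exact: lt_le_trans h (util_le_best _ _ _).
apply: fin_bigcup_measurable => // x _.
have [mu _] := bounded_mfun_util x.
by rewrite -[X in measurable X]setTI; apply: mu.
Qed.

Lemma measurable_zstar x : measurable [set a : Delta | zstar u a x].
Proof.
have -> : [set a : Delta | zstar u a x] =
    (fun a => util u a x + -1 * best_util u a) @^-1` [set 0].
  apply/seteqP; split=> a /=.
    by move/zstarP => ->; rewrite mulN1r subrr.
  by rewrite mulN1r => /subr0_eq h; apply/zstarP.
have [mf _] := bounded_mfunD _ _ (bounded_mfun_util x)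
  (bounded_mfunZ (-1) _ bounded_mfun_best_util).
by rewrite -[X in measurable X]setTI; apply: mf.
Qed.

End measurability.

Section chain.
Context {R : realType} {n : nat} {X : actionType}.
Local Notation Delta := (worldview R n).
Variable Pi : R.-pker Delta ~> (discrete X * Delta)%type.
Context {d : measure_display} {Omega : measurableType d}.
Variables (al : nat -> Omega -> Delta) (xs : nat -> Omega -> discrete X).
Variables (P : probability Omega R) (b : Delta).
Hypothesis chain : chain_law Pi al xs P b.

Lemma measurable_discrete (A : set (discrete X)) : measurable A.
Proof. by []. Qed.

Lemma bounded_mfun_action (g : X -> R) : bounded_mfun (g : discrete X -> R).
Proof.
split; first by move=> _ A _; exact: measurable_discrete.
by exists (\sum_x `|g x|) => x; rewrite (bigD1 (x : X))//= lerDl sumr_ge0.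
Qed.

Lemma measurable_state t : measurable_fun setT (al t).
Proof. by case: chain. Qed.

Lemma measurable_action t : measurable_fun setT (xs t).
Proof. by case: chain. Qed.

Lemma measurable_transition t :
  measurable_fun setT (fun w => (xs t w, al t.+1 w)).
Proof.
by apply: measurable_fun_pair;
  [exact: measurable_action|exact: measurable_state].
Qed.

Lemma history_state t (C : set Delta) : measurable C ->
  history al xs t (al t @^-1` C).
Proof. by move=> mC; apply: sub_sigma_algebra; left; exists t, C. Qed.

Lemma chain_mean_step t (g : discrete X * Delta -> R) : bounded_mfun g ->
  \int[P]_w g (xs t w, al t.+1 w) = \int[P]_w \int[Pi (al t w)]_z g z.
Proof.
move=> bg.
apply: (mean_mixture Pi (al t) _ P (fun w => (xs t w, al t.+1 w))) => //.
- exact: measurable_state.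
- exact: measurable_transition.
move=> B mB; have [_ _ _ /(_ t setT B)] := chain; rewrite setTI; apply => //.
exact: (history_state t setT).
Qed.

(** Induction for all [h] at once: going back one date replaces [h] by [next_mean Pi h], and at date
    0 the state is almost surely [b]. *)
Lemma chain_mean_state m (h : Delta -> R) : bounded_mfun h ->
  \int[P]_w h (al m w) = iter m (next_mean Pi) h b.
Proof.
elim: m h => [|m IH] h bh.
  have al0 : {ae P, forall w, al 0 w = b}.
    have [_ _ h0 _] := chain; apply: (full_measure_ae _ (probability_setT P) _
      _ h0).
    rewrite -[X in measurable X]setTI; apply: measurable_state => //.
    exact: measurable_worldview1.
  rewrite -[RHS](mean_cst P (probability_setT P)).
  apply: mean_eq_ae.
  - exact: bounded_mfun_comp (measurable_state 0) bh.
  - exact: bounded_mfun_cst.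
  - by apply: filterS al0 => w /= ->.
rewrite iterSr -IH; last exact: bounded_mfun_next_mean.
exact: (chain_mean_step m (fun z => h z.2) (bounded_mfun_comp _ _
  measurable_snd bh)).
Qed.

Lemma chain_mean_action m (g : X -> R) :
  \int[P]_w g (xs m w) =
  iter m (next_mean Pi) (fun y => \int[Pi y]_z g z.1) b.
Proof.
have bg := bounded_mfun_comp _ _ (@measurable_fst _ _ (discrete X) Delta)
  (bounded_mfun_action g).
rewrite -chain_mean_state; last exact: bounded_mfun_kernel bg.
exact: chain_mean_step bg.
Qed.

End chain.

(** * Almost sure convergence in randomized equilibria *)

Section randomized_equilibrium.
Context {R : realType} {n : nat} {X : actionType}.
Variable u : 'I_n.+1 -> X -> R.
Local Notation Delta := (worldview R n).
Variables lambda delta : R.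
Hypotheses (hlambda : 0 < lambda < 1) (hdelta : 0 < delta < 1).
Variable Pi : R.-pker Delta ~> (discrete X * Delta)%type.
Context {d : measure_display} {Omega : measurableType d}.
Variables (al : nat -> Omega -> Delta) (xs : nat -> Omega -> discrete X).
Variable P : Delta -> probability Omega R.
Hypothesis chain : forall b, chain_law Pi al xs (P b) b.
Hypothesis mpe : randomized_MPE u lambda delta Pi al xs P.

Definition mean_action (g : X -> R) (b : Delta) : R := \int[Pi b]_z g z.1.

Let bounded_fst (g : X -> R) :
  bounded_mfun (fun z : discrete X * Delta => g z.1).
Proof. exact: bounded_mfun_comp _ _ measurable_fst (bounded_mfun_action g). Qed.

Let bounded_snd (h : Delta -> R) : bounded_mfun h ->
  bounded_mfun (fun z : discrete X * Delta => h z.2).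
Proof. exact: bounded_mfun_comp measurable_snd. Qed.

Let bounded_mean_action g : bounded_mfun (mean_action g).
Proof. exact: bounded_mfun_kernel (bounded_fst g). Qed.

Lemma action_optimal_ae b : {ae Pi b, forall z, zstar u b z.1}.
Proof.
apply: (full_measure_ae (Pi b) (prob_kernel b) [set z : discrete X * Delta |
  zstar u b z.1]).
  rewrite -[X in measurable X]setTI; apply: measurable_fst => //.
exact: (mpe b).1.
Qed.

Lemma mean_action_eq b g c : (forall y, zstar u b y -> g y = c) ->
  mean_action g b = c.
Proof.
move=> gc; rewrite -[RHS](mean_cst (Pi b) (prob_kernel b)).
apply: mean_eq_ae => //; first exact: bounded_mfun_cst.
by apply: sub_ae (action_optimal_ae b) => z /gc.
Qed.

Lemma mean_action_le b g c : (forall y, zstar u b y -> g y <= c) ->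
  mean_action g b <= c.
Proof.
(* The bound on [g] holds only almost surely, so [g] is first truncated at [c]. *)
move=> gc; rewrite -[leRHS](mean_cst (Pi b) (prob_kernel b)).
pose g' y := Num.min (g y) c.
rewrite /mean_action (mean_eq_ae _ _ (fun z : discrete X * Delta => g' z.1))//.
- apply: mean_le => //; first exact: prob_kernel.
  + exact: bounded_mfun_cst.
  + by move=> z; rewrite /g' ge_min lexx orbT.
- by apply: sub_ae (action_optimal_ae b) => z /gc /min_idPl.
Qed.

Lemma state_action_optimal_ae b k :
  {ae P b, forall w, zstar u (al k w) (xs k w)}.
Proof.
(* The event that [y] is played at date [k] without being optimal. By the chain law its probability
   is an integral of null probabilities. *)
pose N y := (al k @^-1` ~` [set a | zstar u a y]) `&` (xs k @^-1` [set y]).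
have mZ y : measurable (~` [set a : Delta | zstar u a y]).
  by apply: measurableC; exact: measurable_zstar.
have mN y : measurable (N y).
  apply: measurableI; rewrite -[X in measurable X]setTI.
    by apply: (measurable_state _ _ _ _ _ (chain b)).
  by apply: (measurable_action _ _ _ _ _ (chain b)).
have N0 y : P b (N y) = 0%E.
  have [_ _ _ /(_ k _ (fst @^-1` [set y]) (history_state _ _ k _ (mZ y)))] :=
    chain b.
  rewrite /= => -> //; last first.
    by rewrite -[X in measurable X]setTI; apply: measurable_fst.
  apply: integral0_eq => w /= aky.
  have [A [mA A0 AN]] := action_optimal_ae (al k w).
  apply: subset_measure0 A0 => //.
    by rewrite -[X in measurable X]setTI; apply: measurable_fst.
  by move=> z /= zy; apply: AN => /=; rewrite zy.
have : (P b).-negligible (\bigcup_(y in [set: X]) N y).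
  apply: negligible_countable_bigcup => y.
  by apply/negligibleP; [exact: mN|exact: N0].
by move=> N_null; apply: (negligibleS _ N_null) => w /= h; exists (xs k w).
Qed.

(** [A] and [V j] are the expected discounted sums of the maximal utility and of the payoff [u j].
    [C] assembles them into the value of a state, [F] averages that value over the next state, and
    [S] is the equilibrium payoff. *)
Let A := resolvent Pi delta (best_util u).
Let V j := resolvent Pi delta (mean_action (u j)).

Let bA : bounded_mfun A.
Proof. by apply: bounded_mfun_resolvent => //;
  exact: bounded_mfun_best_util. Qed.

Let bV j : bounded_mfun (V j).
Proof. exact: bounded_mfun_resolvent. Qed.

Let C (b a : Delta) : R := (1 - lambda) * A b + lambda * \sum_j val a ord0 j *
  V j b.

Let F (b a : Delta) : R := (1 - lambda) * next_mean Pi A b +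
  lambda * \sum_j val a ord0 j * next_mean Pi (V j) b.

Let S (a : Delta) : R := F a a.

(** The mean of the path value is taken term by term. Actions are almost surely optimal, so utility
    at the current state contributes [best_util], while the weights [a] remain outside as
    coefficients. *)
Lemma randomized_valueE b a : randomized_value u lambda delta al xs P b a = C
  b a.
Proof.
have bu k : bounded_mfun (fun w => util u (al k w) (xs k w)).
  apply: bounded_mfun_sum => j; split.
    apply: measurable_funM.
    - exact: measurableT_comp (measurable_weight j) (measurable_state _ _ _ _
        _ (chain b) k).
    - have [mu _] := bounded_mfun_action (u j).
      exact: measurableT_comp mu (measurable_action _ _ _ _ _ (chain b) k).
  exists (payoff_bound u) => w.
  rewrite normrM ger0_norm ?worldview_ge0// -[leRHS]mul1r.
  by rewrite ler_pM ?worldview_ge0 ?worldview_le1 ?le_payoff_bound.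
have bj k j : bounded_mfun (fun w => u j (xs k w)).
  exact: bounded_mfun_comp (measurable_action _ _ _ _ _ (chain b) k)
    (bounded_mfun_action (u j)).
have P1 := probability_setT (P b).
have bdu : bounded_mfun (fun w => discounted delta (fun k => util u (al k w)
  (xs k w))).
  apply: (bounded_mfun_discounted _ hdelta (payoff_bound u)) => [k|k w].
    by have [] := bu k.
  exact: util_le_bound.
have bdj j : bounded_mfun (fun w => discounted delta (fun k => u j (xs k w))).
  apply: (bounded_mfun_discounted _ hdelta (payoff_bound u)) => [k|k w].
    by have [] := bj k j.
  exact: le_payoff_bound.
rewrite /randomized_value unlock -/(Rintegral (P b) setT _).
under eq_Rintegral do rewrite path_value_split//.
rewrite meanD//; last 2 first.
- exact: bounded_mfunZ.
- by apply: bounded_mfunZ; apply: bounded_mfun_sum => j; exact: bounded_mfunZ.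
rewrite !meanZ//; last first.
  by apply: bounded_mfun_sum => j; exact: bounded_mfunZ.
rewrite mean_sum//; last by move=> j; exact: bounded_mfunZ.
congr (_ * _ + _ * _).
  rewrite (mean_discounted _ hdelta (payoff_bound u)
    (fun k w => util u (al k w) (xs k w)))//; last 2 first.
  - by move=> k; have [] := bu k.
  - by move=> k w; exact: util_le_bound.
  congr discounted; apply/funext => k.
  rewrite -(chain_mean_state _ _ _ _ _ (chain b));
    last exact: bounded_mfun_best_util.
  apply: mean_eq_ae => //.
    exact: bounded_mfun_comp (measurable_state _ _ _ _ _ (chain b) k)
      (bounded_mfun_best_util u).
  by apply: filterS (state_action_optimal_ae b k) => w /zstarP.
apply: eq_bigr => j _; rewrite meanZ//; congr (_ * _).
rewrite (mean_discounted _ hdelta (payoff_bound u) (fun k w => u j (xs k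
  w)))//; last 2 first.
- by move=> k; have [] := bj k j.
- by move=> k w; exact: le_payoff_bound.
by congr discounted; apply/funext => k;
  exact: (chain_mean_action _ _ _ _ _ (chain b)).
Qed.

Let bC a : bounded_mfun (C ^~ a).
Proof.
apply: bounded_mfunD; apply: bounded_mfunZ => //.
by apply: bounded_mfun_sum => j; exact: bounded_mfunZ.
Qed.

Let F_next b a : F b a = next_mean Pi (C ^~ a) b.
Proof.
have P1 := prob_kernel (s := Pi) b.
rewrite /next_mean meanD//; last 2 first.
- by apply: bounded_mfunZ; exact: bounded_snd.
- apply: bounded_mfunZ; apply: bounded_mfun_sum => j; apply: bounded_mfunZ.
  exact: bounded_snd.
rewrite !meanZ//; last 2 first.
- exact: bounded_snd.
- by apply: bounded_mfun_sum => j; apply: bounded_mfunZ; exact: bounded_snd.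
rewrite mean_sum//; last by move=> j; apply: bounded_mfunZ; exact: bounded_snd.
by congr (_ + _ * _); apply: eq_bigr => j _; rewrite meanZ//;
  exact: bounded_snd.
Qed.

Let C_rec b a : C b a = (1 - lambda) * best_util u b +
  lambda * mean_action (util u a) b + delta * F b a.
Proof.
have -> : mean_action (util u a) b = \sum_j val a ord0 j * mean_action (u j) b.
  rewrite /mean_action mean_sum ?prob_kernel//; last by move=> j;
    exact: bounded_mfunZ.
  by apply: eq_bigr => j _; rewrite meanZ// prob_kernel.
rewrite /C /F /A (resolvent_rec _ _ hdelta); last exact: bounded_mfun_best_util.
have -> : \sum_j val a ord0 j * V j b =
    \sum_j val a ord0 j * mean_action (u j) b +
    delta * \sum_j val a ord0 j * next_mean Pi (V j) b.
  rewrite mulr_sumr -big_split/=; apply: eq_bigr => j _.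
  by rewrite /V (resolvent_rec _ _ hdelta)//; ring.
ring.
Qed.

Let C_le c a : C c a <= S a.
Proof.
have := (mpe a).2 c; rewrite randomized_valueE.
under eq_Rintegral do rewrite randomized_valueE.
move=> /le_trans; apply; rewrite /S F_next /next_mean /Rintegral.
rewrite integral_pushforward//.
- by apply/measurable_EFinP; have [] := bC a.
- exact: bounded_mfun_integrable (prob_kernel a) _ (bounded_snd _ (bC a)).
Qed.

Let F_le b a : F b a <= S a.
Proof.
rewrite F_next -[leRHS](mean_cst (Pi b) (prob_kernel b)); apply: mean_le.
- exact: prob_kernel.
- exact: bounded_snd _ (bC a).
- exact: bounded_mfun_cst.
- by move=> z; exact: C_le.
Qed.

(** Among the actions optimal at [b], one that is best for the weights [a] bounds the mean payoff of
    the random action; the continuation is at most [S a]. *)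
Let C_transition a b : C b a = S a -> transition u lambda delta S a b.
Proof.
move=> CS; have [y yb ymax] : exists2 y, zstar u b y &
    forall x, zstar u b x -> util u a x <= util u a y.
  pose y := [arg max_(x > best u b | `[< zstar u b x >]) util u a x]%O.
  exists y; rewrite /y; case: arg_maxP => //; do ?exact/asboolP/zstar_best.
    by move=> x /asboolP.
  by move=> x _ h z zb; apply: h; exact/asboolP.
exists y => //; have := C_rec b a; rewrite CS.
have := mean_action_le b (util u a) _ ymax; have := F_le b a.
have [l0 l1] := andP hlambda; have [d0 d1] := andP hdelta.
move: (mean_action _ _) (F _ _) (S a) => m f s; nra.
Qed.

Let transition_ae a : {ae Pi a, forall z, transition u lambda delta S a z.2}.
Proof.
have CS : \int[Pi a]_z C z.2 a = S a by rewrite /S F_next.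
have := mean_max_ae (Pi a) (prob_kernel a) _ _ (bounded_snd _ (bC a))
  (fun z => C_le z.2 a) CS.
by apply: sub_ae => z; exact: C_transition.
Qed.

Let bS : bounded_mfun S.
Proof.
apply: bounded_mfunD; apply: bounded_mfunZ; first exact: bounded_mfun_next_mean.
apply: bounded_mfun_sum => j.
have [mv [K hK]] := bounded_mfun_next_mean Pi (V j) (bV j).
split; first by apply: measurable_funM => //; exact: measurable_weight.
exists K => a; rewrite normrM ger0_norm ?worldview_ge0//.
by rewrite (le_trans _ (hK a))// ler_piMl// worldview_le1.
Qed.

(* [chain_law] gives the law of two successive states on rectangles only, so the
   failure of [transition] is covered by countably many null rectangles. *)
Lemma chain_transition_ae b t :
  {ae P b, forall w, transition u lambda delta S (al t w) (al t.+1 w)}.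
Proof.
(* If the move from [a] to [c] is not a transition, then for each [y] optimal at [c] some rational
   [q y] separates [(1 - lambda) * best_util u c] from the larger
   [(1 - delta) * S a - lambda * util u a y]; then [a] is in [Aq q] and [c] in [Bq q]. *)
pose Aq (q : {ffun X -> rat}) : set Delta := [set a | forall y,
  ratr (q y) < (1 - delta) * S a - lambda * util u a y].
pose Bq (q : {ffun X -> rat}) : set Delta := [set a | forall y,
  zstar u a y -> (1 - lambda) * best_util u a <= ratr (q y)].
have mAq q : measurable (Aq q).
  have -> : Aq q = \bigcap_(y in [set: X])
      ((fun a => (1 - delta) * S a + - lambda * util u a y) @^-1`
        `]ratr (q y), +oo[%classic).
    apply/seteqP; split=> a aq y => [_|] /=; last first.
      by have := aq y I; rewrite /= in_itv/= andbT mulNr.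
    by have := aq y; rewrite in_itv/= andbT mulNr.
  apply: fin_bigcap_measurable => // y _; rewrite -[X in measurable X]setTI.
  by have [mf _] := bounded_mfunD _ _ (bounded_mfunZ (1 - delta) _ bS)
    (bounded_mfunZ (- lambda) _ (bounded_mfun_util u y)); apply: mf.
have mBq q : measurable (Bq q).
  have -> : Bq q = \bigcap_(y in [set: X]) (~` [set a | zstar u a y] `|`
      (fun a => (1 - lambda) * best_util u a) @^-1` `]-oo, ratr (q y)]%classic).
    apply/seteqP; split=> a aq y => [_|ay] /=.
      have [ay|] := pselect (zstar u a y); last by left.
      by right; rewrite in_itv/=; exact: aq.
    by have [//|] := aq y I; rewrite /= in_itv.
  apply: fin_bigcap_measurable => // y _; apply: measurableU.
    by apply: measurableC; exact: measurable_zstar.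
  rewrite -[X in measurable X]setTI.
  by have [mf _] := bounded_mfunZ (1 - lambda) _ (bounded_mfun_best_util u);
    apply: mf.
have AB0 q : P b ((al t @^-1` Aq q) `&` (al t.+1 @^-1` Bq q)) = 0%E.
  have [_ _ _ /(_ t _ (snd @^-1` Bq q) (history_state _ _ t _ (mAq q)))] :=
    chain b.
  rewrite /= => -> //; last first.
    by rewrite -[X in measurable X]setTI; apply: measurable_snd.
  apply: integral0_eq => w /= aA.
  have [N [mN N0 hN]] := transition_ae (al t w).
  apply: subset_measure0 N0 => //.
    by rewrite -[X in measurable X]setTI; apply: measurable_snd.
  move=> z /= zB; apply: hN => /= -[y yz].
  by have := aA y; have := zB y yz; lra.
have cov a c : ~ transition u lambda delta S a c -> exists q, Aq q a /\ Bq q c.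
  move=> ntr; have hy y : exists r : rat,
      ratr r < (1 - delta) * S a - lambda * util u a y /\
      (zstar u c y -> (1 - lambda) * best_util u c <= ratr r).
    have [yc|nyc] := pselect (zstar u c y).
      have : (1 - lambda) * best_util u c < (1 - delta) * S a - lambda * util
        u a y.
        rewrite ltNge; apply/negP => h; apply: ntr; exists y => //; lra.
      move=> /rat_in_itvoo [r]; rewrite in_itv/= => /andP[r1 r2].
      by exists r; split=> // _; exact: ltW.
    (* For [y] not optimal at [c] any rational below the bound will do; the length 1 is
       arbitrary. *)
    have [r] := @rat_in_itvoo R ((1 - delta) * S a - lambda * util u a y - 1)
      ((1 - delta) * S a - lambda * util u a y) ltac:(lra).
    by rewrite in_itv/= => /andP[_ r2]; exists r.
  have [q hq] := choice hy; exists (finfun q).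
  by split=> y; rewrite ffunE; have [] := hq y.
have : (P b).-negligible (\bigcup_(q in [set: {ffun X -> rat}])
    ((al t @^-1` Aq q) `&` (al t.+1 @^-1` Bq q))).
  apply: negligible_countable_bigcup => q; apply/negligibleP; last exact: AB0.
  by apply: measurableI; rewrite -[X in measurable X]setTI;
    apply: (measurable_state _ _ _ _ _ (chain b)).
by move=> AB_null; apply: (negligibleS _ AB_null) => w /= /cov [q [Aw Bw]];
  exists q.
Qed.

(** Outside one null set all countably many moves are transitions; there the deterministic argument
    applies path by path. *)
Lemma randomized_MPE_cvg
  (hu : forall x : X, implementable u x ->
    exists i : 'I_n.+1, zstar u (vertex R i) x /\
      forall j : 'I_n.+1, j != i -> u j x < u i x) a0 :
  {ae P a0, forall w, exists i : 'I_n.+1, al t w @[t --> \oo] --> vertex R i}.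
Proof.
have /ae_foralln := chain_transition_ae a0; apply: filterS => w /=.
apply: (transition_cvg u hu _ _ hlambda hdelta S F) => //.
- by move=> b a a'; rewrite /F !dot_midpoint; lra.
- move=> a b ba; have := C_le b a; rewrite C_rec.
  by rewrite (mean_action_eq _ _ (best_util u a))// => y /ba /zstarP.
Qed.

End randomized_equilibrium.

Theorem corollary6p5 (R : realType) (n : nat) (X : actionType)
  (u : 'I_n.+1 -> X -> R)
  (hu : forall x : X, implementable u x ->
    exists i : 'I_n.+1, zstar u (vertex R i) x /\
      forall j : 'I_n.+1, j != i -> u j x < u i x)
  (lambda delta : R)
  (hlambda : 0 < lambda < 1) (hdelta : 0 < delta < 1) :
  (forall (phi : worldview R n -> worldview R n) (z : worldview R n -> X),
     pure_MPE u lambda delta phi z ->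
     forall a0 : worldview R n, exists i : 'I_n.+1,
       iter t phi a0 @[t --> \oo] --> vertex R i)
  /\
  (forall (Pi : R.-pker (worldview R n) ~> (discrete X * worldview R n)%type)
     (d : measure_display) (Omega : measurableType d)
     (al : nat -> Omega -> worldview R n) (xs : nat -> Omega -> discrete X)
     (P : worldview R n -> probability Omega R),
     (forall b : worldview R n, chain_law Pi al xs (P b) b) ->
     randomized_MPE u lambda delta Pi al xs P ->
     forall a0 : worldview R n,
       {ae P a0, forall w, exists i : 'I_n.+1,
         al t w @[t --> \oo] --> vertex R i}).
Proof.
split=> [phi z mpe a0|Pi d Omega al xs P chain mpe a0].
  exact: pure_MPE_cvg mpe.
exact: randomized_MPE_cvg mpe hu a0.
Qed.
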